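(* For every integer $n\ge 1$, \[ s(n)\le \frac{7}{2}\,n\log_2 n+4n, \] where $s(n)$ denotes the minimum number of edges of an $n$-vertex graph that contains every $n$-vertex tree as a subgraph.
   Context: Graphs are finite and simple. A graph $G$ contains $H$ as a subgraph if $G$ has a (not necessarily induced) subgraph isomorphic to $H$. The number $s(n)$ is the minimum of $e(G)$ over all graphs $G$ on exactly $n$ vertices such that every tree on $n$ vertices is isomorphic to a (necessarily spanning) subgraph of $G$. *)

(* Defs.v *)
From HB Require Import structures.
From mathcomp Require Import all_boot all_order all_algebra.
From mathcomp Require Import boolp reals exp.

Set Implicit Arguments.
Unset Strict Implicit.
Unset Printing Implicit Defensive.

Record sgraph (V : finType) := SGraph {
  adj :> rel V;
  adj_sym : symmetric adj;
  adj_irr : irreflexive adj }.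

Definition edges (V : finType) (G : sgraph V) : {set {set V}} :=
  [set [set p.1; p.2] | p : V * V & G p.1 p.2].

Definition num_edges (V : finType) (G : sgraph V) : nat := #|edges G|.

Definition isomorphic (V W : finType) (G : sgraph V) (H : sgraph W) : Prop :=
  exists2 f : V -> W, bijective f & forall x y, G x y = H (f x) (f y).

Definition is_subgraph (V : finType) (W : {set V})
    (K : sgraph {x : V | x \in W}) (G : sgraph V) : Prop :=
  forall x y, K x y -> G (val x) (val y).

Definition contains (V U : finType) (G : sgraph V) (H : sgraph U) : Prop :=
  exists (W : {set V}) (K : sgraph {x : V | x \in W}),
    is_subgraph K G /\ isomorphic H K.

Definition graph_connected (V : finType) (G : sgraph V) : Prop :=
  0 < #|V| /\ forall x y, connect G x y.

(* A repetition-free closed walk of length at most 2 is a point or a single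
   edge traversed back and forth; the graph cycles are those of length > 2. *)
Definition acyclic (V : finType) (G : sgraph V) : Prop :=
  forall c : seq V, ucycle G c -> size c <= 2.

Definition is_tree (V : finType) (G : sgraph V) : Prop :=
  graph_connected G /\ acyclic G.

(* Containment is isomorphism-invariant, so 'I_n serves as the vertex set of
   all n-vertex graphs and trees. *)
Definition tree_universal (n : nat) (G : sgraph 'I_n) : Prop :=
  forall T : sgraph 'I_n, is_tree T -> contains G T.

Definition universal_size (n m : nat) : Prop :=
  exists2 G : sgraph 'I_n, tree_universal G & num_edges G = m.

Definition complete_rel (V : finType) : rel V := [rel x y | x != y].

Lemma complete_sym (V : finType) : symmetric (@complete_rel V).
Proof. by move=> x y; rewrite /complete_rel /= eq_sym. Qed.

Lemma complete_irr (V : finType) : irreflexive (@complete_rel V).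
Proof. by move=> x; rewrite /complete_rel /= eqxx. Qed.

Definition complete_graph (V : finType) : sgraph V :=
  SGraph (@complete_sym V) (@complete_irr V).

Lemma complete_universal (n : nat) : tree_universal (complete_graph 'I_n).
Proof.
move=> T _; pose W := [set: 'I_n].
pose k := [rel x y : {x : 'I_n | x \in W} | T (val x) (val y)].
have ks : symmetric k by move=> x y; rewrite /= adj_sym.
have ki : irreflexive k by move=> x; rewrite /= adj_irr.
exists W, (SGraph ks ki); split.
  by move=> x y /= Txy; apply: contraTneq Txy => ->; rewrite adj_irr.
exists (fun x => Sub x (in_setT x)) => //.
by exists val => [x|x] //; apply: val_inj.
Qed.

Lemma universal_size_ex (n : nat) : exists m, `[< universal_size n m >].
Proof.
exists (num_edges (complete_graph 'I_n)); apply/asboolP.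
by exists (complete_graph 'I_n) => //; apply: complete_universal.
Qed.

Definition s (n : nat) : nat := ex_minn (universal_size_ex n).

Definition log2 (R : realType) (x : R) : R := (ln x / ln 2)%R.

(* Main.v *)
(* Put the vertices at positions 1, ..., n and let p see every q with
   |p - q| < 3 * 2^v, where v is the 2-adic valuation of p; join p and q when one
   of them sees the other.  The windows have total size at most
   3 n log2 n + 4 n.

   Every forest embeds in every interval of positions with at most one hole, the
   hole being occupied by an earlier vertex that sees the whole interval.  If
   there is no hole, any vertex may go to the position p of highest valuation,
   which sees the interval and becomes the hole.  Otherwise let the hole h have
   a <= b free positions on its left and right (the other case is symmetric),
   let u be the largest power of 2 with u <= b, and put d = b - u < u.  The
   position p = h + u sees the whole interval, because a and b stay below twice
   the largest power of 2 dividing h, so that u divides p.  Some vertex w of the forest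
   splits off a union D of components of its complement with d <= #|D| < 2 d
   (or D empty, if d = 0).  Place w at p, D around p at the right end, and the
   remaining forest around h: both pieces are again intervals with one hole. *)
Require Import Defs.
From mathcomp Require Import all_boot all_order all_algebra.
From mathcomp Require Import reals exp.
From mathcomp Require Import zify lra.
Import Order.TTheory GRing.Theory Num.Theory.
Local Open Scope ring_scope.

Set Implicit Arguments.
Unset Strict Implicit.
Unset Printing Implicit Defensive.

Local Open Scope nat_scope.

(** * Splitting a forest at a vertex *)

(** A simple path from [y] to [z] inside [D] closes up through [w] to a cycle, which is too long
    unless the path is trivial. *)
Lemma acyclic_unique_neighbor (V : finType) (T : sgraph V) (D : {set V})
    (w y z : V) :
  acyclic T -> w \notin D -> y \in D -> T w y -> T w z ->
  connect [rel a b | (b \in D) && T a b] y z -> y = z.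
Proof.
move=> acT wD yD Twy Twz /connectP[p0 p0P zE].
case: (shortenP p0P) zE => p pP pU _ {p0P} zE.
have pD : {subset p <= D}.
  elim: p y pP {pU zE Twy yD} => [//|b p IH] y /= /andP[/andP[bD _] /IH pD] c.
  by rewrite inE => /predU1P[-> //|/pD].
have pT : path T y p by apply: sub_path pP => a b /andP[].
have /acT : ucycle T (w :: y :: p).
  rewrite /ucycle /= Twy rcons_path pT -zE adj_sym Twz inE negb_or /=.
  rewrite -[X in _ && X]/(uniq (y :: p)) pU !andbT; apply/andP; split.
    by apply: contraNneq wD => ->.
  by apply: contra wD => /pD.
by case: p zE {pP pU pD pT} => [->|].
Qed.

(** Equivalently, [D] is a union of components of the forest induced on [A]. *)
Definition isolated (V : finType) (T : sgraph V) (A D : {set V}) : bool :=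
  (D \subset A) && [forall y in D, forall z in A, T y z ==> (z \in D)].

Lemma isolatedP (V : finType) (T : sgraph V) (A D : {set V}) :
  reflect (D \subset A /\
           forall y z, y \in D -> z \in A -> T y z -> z \in D)
          (isolated T A D).
Proof.
apply: (iffP andP) => -[DA clD]; split=> //.
  move=> y z yD zA; move/forall_inP: clD => /(_ y yD)/forall_inP/(_ z zA).
  exact: implyP.
apply/forall_inP => y yD; apply/forall_inP => z zA; apply/implyP.
exact: clD.
Qed.

(* A set [D] with at least [x] elements that is isolated outside [w] and of least
   cardinality is connected once #|D| >= 2 x, so [w] has at most one neighbor in
   [D]; moving [w] to that neighbor shrinks [D]. *)
Lemma acyclic_split (V : finType) (T : sgraph V) (A : {set V}) (x : nat) :
  acyclic T -> x < #|A| ->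
  exists w D, [/\ w \in A, isolated T (A :\ w) D & x <= #|D| <= x.*2.-1].
Proof.
move=> acT xA; have [w0 w0A] : exists w, w \in A.
  by apply/card_gt0P; apply: leq_ltn_trans xA.
case: x xA => [|x] xA.
  exists w0, set0; split=> //; last by rewrite cards0.
  by apply/isolatedP; split=> [|y z]; rewrite ?sub0set ?inE.
pose good (u : V * {set V}) :=
  [&& u.1 \in A, isolated T (A :\ u.1) u.2 & x < #|u.2|].
have good0 : good (w0, A :\ w0).
  apply/and3P; split=> //=; first by apply/isolatedP.
  by move: xA; rewrite (cardsD1 w0) w0A.
have [[w D] /= /and3P[/= wA /isolatedP[DA clD] xD] minD] :=
  arg_minnP (fun u : V * {set V} => #|u.2|) good0.
exists w, D; split=> //; first exact/isolatedP.
rewrite xD /= leqNgt; apply/negP => bigD.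
have wD : w \notin D by apply/negP => /(subsetP DA); rewrite !inE eqxx.
have minDP E v : v \in A -> isolated T (A :\ v) E -> E \proper D -> #|E| <= x.
  move=> vA clE /proper_card ED; rewrite leqNgt; apply/negP => xE.
  by have := minD (v, E); rewrite /good /= vA clE xE => /(_ isT); lia.
have [y yD] : exists y, y \in D by apply/card_gt0P; lia.
pose r := [rel a b | (b \in D) && T a b].
pose E := [set z in D | connect r y z].
(* Otherwise [E] and [D :\: E] are both isolated proper subsets of [D], so by minimality each has at
   most [x] elements, against [bigD]. *)
have ED : E = D.
  apply/eqP; rewrite eqEsubset; apply/andP; split.
    by apply/subsetP => z; rewrite inE => /andP[].
  apply/negPn/negP => /negP DnE.
  have subED : E \subset D by apply/subsetP => z; rewrite inE => /andP[].
  have propE : E \proper D by rewrite properE subED; apply/negP.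
  have yE : y \in E by rewrite inE yD connect0.
  have propE' : D :\: E \proper D.
    by apply/properP; split; [exact: subsetDl|exists y; rewrite // in_setD yE].
  have cE : #|E| <= x.
    apply: (minDP E w) propE => //; apply/isolatedP; split.
      exact: subset_trans DA.
    move=> a b; rewrite inE => /andP[aD ya] bA Tab; have bD := clD a b aD bA Tab.
    rewrite inE bD; apply: connect_trans ya (connect1 _).
    by rewrite /= bD.
  have cE' : #|D :\: E| <= x.
    apply: (minDP (D :\: E) w) propE' => //; apply/isolatedP; split.
      by apply: subset_trans DA; exact: subsetDl.
    move=> a b; rewrite inE => /andP[aE aD] bA Tab; have bD := clD a b aD bA Tab.
    rewrite inE bD andbT; apply: contra aE; rewrite !inE aD bD => yb.
    by apply: connect_trans yb (connect1 _); rewrite /= aD adj_sym.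
  by have := cardsID E D; rewrite (setIidPr subED); clear -bigD cE cE'; lia.
have conD a b : a \in D -> b \in D -> connect r a b.
  rewrite -ED !inE => /andP[aD /connectP[p pP ->]] /andP[bD yb].
  apply: connect_trans yb.
  elim/last_ind: p pP {aD} => [//|p c IH]; rewrite rcons_path last_rcons.
  move=> /andP[pP /andP[cD Tc]]; apply: connect_trans (IH pP).
  apply: connect1; rewrite /= adj_sym Tc andbT.
  elim/last_ind: p pP {IH Tc} => [//|p d _]; rewrite rcons_path last_rcons.
  by case/and3P.
(* If [w] has no neighbor in [D], any element of [D] serves as [w']. *)
have [w' w'D nbr] : exists2 w', w' \in D & forall z, z \in D -> T w z -> z = w'.
  have [/existsP[z /andP[zD Twz]]|/existsPn nonbr] :=
    boolP [exists z, (z \in D) && T w z].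
    exists z => // z' z'D Twz'; apply/esym.
    exact: acyclic_unique_neighbor acT wD zD Twz Twz' (conD _ _ zD z'D).
  by exists y => // z zD Twz; have := nonbr z; rewrite zD Twz.
have := minDP (D :\ w') w'; rewrite properD1 // => /(_ _ _ isT).
have w'A : w' \in A by have := subsetP DA _ w'D; rewrite inE => /andP[].
have := cardsD1 w' D; rewrite w'D => cD.
suff cl' : isolated T (A :\ w') (D :\ w') by move=> /(_ w'A cl'); lia.
apply/isolatedP; split.
  apply: setSD; apply: subset_trans DA _; exact: subsetDl.
move=> a b /setD1P[aw' aD] /setD1P[bw' bA] Tab; rewrite in_setD1 bw' /=.
have [bw|bw] := eqVneq b w; last by apply: clD aD _ Tab; rewrite !inE bw.
by case/eqP: aw'; apply: nbr => //; rewrite adj_sym -bw.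
Qed.

(** * Ruler adjacency and gluing of embeddings *)

Definition covers (p q : nat) : bool :=
  [&& p != q, p < q + 3 * 2 ^ logn 2 p & q < p + 3 * 2 ^ logn 2 p].

Definition ruler_adj (p q : nat) : bool := covers p q || covers q p.

Lemma coversI (t p q : nat) : 0 < p -> 2 ^ t %| p -> p != q ->
  p < q + 3 * 2 ^ t -> q < p + 3 * 2 ^ t -> covers p q.
Proof.
move=> p0; rewrite pfactor_dvdn // => tp pq lpq lqp.
have : 2 ^ t <= 2 ^ logn 2 p by rewrite leq_exp2l.
by rewrite /covers pq /=; lia.
Qed.

Definition embeds (V : finType) (T : sgraph V) (A : {set V}) (S : pred nat) :=
  exists f : V -> nat, [/\ {in A &, injective f}, {in A, forall x, S (f x)} &
    {in A &, forall x y, T x y -> ruler_adj (f x) (f y)}].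

(** No edge joins [D] to the rest of [A :\ w], so independent embeddings into disjoint position sets
    combine once [w] sits at a position covering both sets. *)
Lemma embeds_cut (V : finType) (T : sgraph V) (A D : {set V}) (w : V) (p : nat)
    (S S1 S2 : pred nat) :
  w \in A -> isolated T (A :\ w) D ->
  embeds T D S1 -> embeds T (A :\ w :\: D) S2 ->
  S p -> (forall q, S1 q -> [&& S q, ~~ S2 q & covers p q]) ->
  (forall q, S2 q -> S q && covers p q) -> embeds T A S.
Proof.
move=> wA /isolatedP[DA clD] [f [fI fS fT]] [g [gI gS gT]] Sp S1P S2P.
have wD : w \notin D by apply/negP => /(subsetP DA); rewrite !inE eqxx.
pose F x := if x == w then p else if x \in D then f x else g x.
have Fw : F w = p by rewrite /F eqxx.
have AP x : x \in A ->
    [\/ x = w, x \in D /\ F x = f x | x \in A :\ w :\: D /\ F x = g x].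
  move=> xA; rewrite /F; have [->|xw] := eqVneq x w; first by constructor 1.
  have [xD|xD] := boolP (x \in D); first by constructor 2.
  by constructor 3; rewrite !inE xw xA xD.
have covD x : x \in D -> covers p (f x).
  by move=> xD; have /and3P[] := S1P _ (fS _ xD).
have covE x : x \in A :\ w :\: D -> covers p (g x).
  by move=> xE; have /andP[] := S2P _ (gS _ xE).
have neqDE x y : x \in D -> y \in A :\ w :\: D -> f x <> g y.
  by move=> xD yE E; have /and3P[_] := S1P _ (fS _ xD); rewrite E gS.
have neqD x : x \in D -> p <> f x by move/covD/and3P => [/eqP].
have neqE x : x \in A :\ w :\: D -> p <> g x by move/covE/and3P => [/eqP].
have noDE x y : x \in D -> y \in A :\ w :\: D -> ~ T x y.
  move=> xD /setDP[yA yD] Txy.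
  by rewrite (clD x y) in yD.
exists F; split.
- move=> x y /AP[->|[xD ->]|[xE ->]] /AP[->|[yD ->]|[yE ->]] //; rewrite ?Fw //.
  + by move/(neqD _ yD).
  + by move/(neqE _ yE).
  + by move/esym/(neqD _ xD).
  + exact: fI.
  + by move/(neqDE _ _ xD yE).
  + by move/esym/(neqE _ xE).
  + by move/esym/(neqDE _ _ yD xE).
  + exact: gI.
- move=> x /AP[->|[xD ->]|[xE ->]]; rewrite ?Fw //.
    by have /and3P[] := S1P _ (fS _ xD).
  by have /andP[] := S2P _ (gS _ xE).
- move=> x y /AP[->|[xD ->]|[xE ->]] /AP[->|[yD ->]|[yE ->]]; rewrite ?Fw => Txy.
  + by rewrite adj_irr in Txy.
  + by rewrite /ruler_adj covD.
  + by rewrite /ruler_adj covE.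
  + by rewrite /ruler_adj covD ?orbT.
  + exact: fT.
  + by case: (noDE x y).
  + by rewrite /ruler_adj covE ?orbT.
  + by case: (noDE y x) => //; rewrite adj_sym.
  + exact: gT.
Qed.

Lemma embeds_sub (V : finType) (T : sgraph V) (A : {set V}) (S S' : pred nat) :
  embeds T A S -> (forall q, S q -> S' q) -> embeds T A S'.
Proof. by move=> [f [fI fS fT]] SS'; exists f; split=> // x /fS/SS'. Qed.

Lemma embeds0 (V : finType) (T : sgraph V) (S : pred nat) : embeds T set0 S.
Proof. by exists (fun _ => 0); split=> [x y|x|x y]; rewrite inE. Qed.

(** * Embedding forests in intervals with at most one hole *)

(** For the largest [t], [p] is an odd multiple of [2 ^ t]; both [p - 2 ^ t] and [p + 2 ^ t] are
    then multiples of [2 ^ t.+1], hence outside the interval. *)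
Lemma interval_top (j k : nat) : 0 < j -> 0 < k ->
  exists p t, [/\ j <= p < j + k, 2 ^ t %| p, p < j + 2 ^ t
                & j + k <= p + 2 ^ t].
Proof.
move=> j0 k0; pose P t := has (fun p => 2 ^ t %| p) (iota j k).
have exP : exists t, P t.
  by exists 0; apply/hasP; exists j; rewrite ?dvd1n // mem_iota; lia.
have ubP t : P t -> t <= j + k.
  move=> /hasP[p]; rewrite mem_iota => pJ /dvdn_leq.
  by have := ltn_expl t (isT : 1 < 2); lia.
case: (ex_maxnP exP ubP) => t /hasP[p]; rewrite mem_iota => pJ /dvdnP[c pE] tmax.
have noP q : j <= q < j + k -> ~~ (2 ^ t.+1 %| q).
  move=> qJ; apply/negP => tq.
  suff /tmax : P t.+1 by rewrite ltnn.
  by apply/hasP; exists q; rewrite ?mem_iota.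
have oc : odd c.
  by have := noP p pJ; rewrite pE expnS dvdn_pmul2r ?expn_gt0 // dvdn2 negbK.
have dvd1 : 2 ^ t.+1 %| p + 2 ^ t.
  by rewrite pE -mulSnr expnS dvdn_mul // dvdn2 /= oc.
have dvd2 : 2 ^ t.+1 %| p - 2 ^ t.
  rewrite pE -[X in _ - X]mul1n -mulnBl expnS dvdn_mul // dvdn2.
  by rewrite oddB ?oc //; case: (c) oc.
exists p, t; rewrite pE dvdn_mull // -pE; split=> //.
  rewrite ltnNge; apply/negP => le; have : j <= p - 2 ^ t < j + k by lia.
  by move/noP; rewrite dvd2.
rewrite leqNgt; apply/negP => lt; have : j <= p + 2 ^ t < j + k by lia.
by move/noP; rewrite dvd1.
Qed.

Lemma embeds_interval_hole (V : finType) (T : sgraph V) (m : nat) (A : {set V}) :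
  acyclic T -> #|A| = m ->
  (forall j, 0 < j -> embeds T A [pred q | j <= q < j + m]) /\
  (forall h a b t, a < h -> a + b = m -> 2 ^ t %| h ->
     a < 2 ^ t.+1 -> b < 2 ^ t.+1 ->
     embeds T A [pred q | (h <= q + a) && (q <= h + b) && (q != h)]).
Proof.
move=> acT; elim/ltn_ind: m A => m IH A cA.
have IHhole (B : {set V}) h a b t : #|B| < m -> a < h -> a + b = #|B| -> 2 ^ t %| h ->
    a < 2 ^ t.+1 -> b < 2 ^ t.+1 ->
    embeds T B [pred q | (h <= q + a) && (q <= h + b) && (q != h)].
  by move=> ltB; apply: (IH _ ltB B erefl).2.
have int j : 0 < j -> embeds T A [pred q | j <= q < j + m].
  move=> j0; have [m0|m0] := posnP m.
    by have /eqP := cA; rewrite m0 cards_eq0 => /eqP ->; exact: embeds0.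
  have [p [t [pJ tp pl pr]]] := interval_top j0 m0.
  have [w wA] : exists w, w \in A by apply/card_gt0P; rewrite cA.
  have cAw : #|A :\ w| = m.-1 by have := cardsD1 w A; rewrite wA; lia.
  have p0 : 0 < p by lia.
  have e1 : embeds T (A :\ w)
      [pred q | (p <= q + (p - j)) && (q <= p + (j + m.-1 - p)) && (q != p)].
    by apply: (IHhole _ _ _ _ t); rewrite ?cAw ?expnS //; lia.
  (* Degenerate cut: [D] is all of [A :\ w] and nothing remains. *)
  have e2 : embeds T (A :\ w :\: (A :\ w)) pred0 by rewrite setDv; exact: embeds0.
  apply: (embeds_cut wA _ e1 e2 pJ) => // [|q /= qJ].
    by apply/isolatedP; split.
  by rewrite (@coversI t) //; lia.
split=> // h a b t ah abm th at_ bt.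
(* With an empty side the positions form an interval without a hole, so the first claim applies for
   the same [m]. *)
have [a0|a0] := posnP a.
  by apply: embeds_sub (int h.+1 _) _ => // q /=; lia.
have [b0|b0] := posnP b.
  by apply: embeds_sub (int (h - a) _) _ => [|q /=]; lia.
have [leab|ltba] := leqP a b.
- have /andP[lo hi] := trunc_log_bounds (isT : 1 < 2) b0.
  set k := trunc_log 2 b in lo hi; rewrite expnS in hi.
  have kt : k <= t.
    by rewrite -ltnS -(ltn_exp2l _ _ (isT : 1 < 2)); apply: leq_ltn_trans bt.
  have kh : 2 ^ k %| h by apply: dvdn_trans th; rewrite dvdn_exp2l.
  have kp : 2 ^ k %| h + 2 ^ k by rewrite dvdn_add.
  have k0 : 0 < 2 ^ k by rewrite expn_gt0.
  have [|w [D [wA iD cD]]] := @acyclic_split V T A (b - 2 ^ k) acT; first by lia.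
  have /isolatedP[DA _] := iD.
  have cE : #|A :\ w :\: D| = m.-1 - #|D|.
    by rewrite cardsD (setIidPr DA); have := cardsD1 w A; rewrite wA; lia.
  have [dlo dhi] : b <= #|D| + 2 ^ k /\ #|D| < b by clear -cD lo hi; lia.
  (* Together with its hole, [D] fills the last [#|D| + 1] positions, up to [h + b]. *)
  have e1 : embeds T D [pred q | (h + 2 ^ k <= q + (#|D| + 2 ^ k - b)) &&
      (q <= h + 2 ^ k + (b - 2 ^ k)) && (q != h + 2 ^ k)].
    by apply: (IHhole _ _ _ _ k) => //; rewrite ?expnS; clear -cA abm dlo dhi lo hi ah; lia.
  have e2 : embeds T (A :\ w :\: D)
      [pred q | (h <= q + a) && (q <= h + (b.-1 - #|D|)) && (q != h)].
    by apply: (IHhole _ _ _ _ t); rewrite ?cE //; clear -abm dlo dhi lo ah at_ bt; lia.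
  apply: (embeds_cut (p := h + 2 ^ k) wA iD e1 e2) => /= [|q|q].
  + by clear -lo k0 ah; lia.
  + case/andP=> /andP[q1 q2] q3.
    have qh : q != h by clear -q1 q2 dlo dhi ah lo; lia.
    have qS : (h <= q + a) && (q <= h + b).
      by clear -q1 q2 dlo dhi ah lo; lia.
    rewrite qh qS andbT /= (@coversI k) //; clear -q1 q2 q3 dlo dhi lo hi k0 ah; lia.
  + case/andP=> /andP[q1 q2] q3.
    have qS : (h <= q + a) && (q <= h + b) by clear -q1 q2 dhi; lia.
    have qp : h + 2 ^ k != q by clear -q1 q2 dlo dhi ah lo k0; lia.
    (* The farthest position is at distance [a + 2 ^ k], below [3 * 2 ^ k] because
       [a <= b < 2 * 2 ^ k]: this is the source of the constant 3. *)
    rewrite q3 qS /= (@coversI k) //; clear -q1 q2 dlo dhi lo hi k0 ah leab; lia.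
(* Mirror image; [2 ^ k <= a < h] keeps [h - 2 ^ k] positive and the subtraction exact. *)
- have /andP[lo hi] := trunc_log_bounds (isT : 1 < 2) a0.
  set k := trunc_log 2 a in lo hi; rewrite expnS in hi.
  have kt : k <= t.
    by rewrite -ltnS -(ltn_exp2l _ _ (isT : 1 < 2)); apply: leq_ltn_trans at_.
  have kh : 2 ^ k %| h by apply: dvdn_trans th; rewrite dvdn_exp2l.
  have kp : 2 ^ k %| h - 2 ^ k by rewrite dvdn_sub.
  have k0 : 0 < 2 ^ k by rewrite expn_gt0.
  have [|w [D [wA iD cD]]] := @acyclic_split V T A (a - 2 ^ k) acT; first by lia.
  have /isolatedP[DA _] := iD.
  have cE : #|A :\ w :\: D| = m.-1 - #|D|.
    by rewrite cardsD (setIidPr DA); have := cardsD1 w A; rewrite wA; lia.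
  have [dlo dhi] : a <= #|D| + 2 ^ k /\ #|D| < a by clear -cD lo hi; lia.
  have e1 : embeds T D [pred q | (h - 2 ^ k <= q + (a - 2 ^ k)) &&
      (q <= h - 2 ^ k + (#|D| + 2 ^ k - a)) && (q != h - 2 ^ k)].
    by apply: (IHhole _ _ _ _ k) => //; rewrite ?expnS; clear -cA abm dlo dhi lo hi ah; lia.
  have e2 : embeds T (A :\ w :\: D)
      [pred q | (h <= q + (a.-1 - #|D|)) && (q <= h + b) && (q != h)].
    by apply: (IHhole _ _ _ _ t); rewrite ?cE //; clear -abm dlo dhi lo ah at_ bt; lia.
  apply: (embeds_cut (p := h - 2 ^ k) wA iD e1 e2) => /= [|q|q].
  + by clear -lo k0 ah; lia.
  + case/andP=> /andP[q1 q2] q3.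
    have qh : q != h by clear -q1 q2 dlo dhi ah lo; lia.
    have qS : (h <= q + a) && (q <= h + b).
      by clear -q1 q2 dlo dhi ah lo; lia.
    rewrite qh qS andbT /= (@coversI k) //; clear -q1 q2 q3 dlo dhi lo hi k0 ah; lia.
  + case/andP=> /andP[q1 q2] q3.
    have qS : (h <= q + a) && (q <= h + b) by clear -q1 q2 dhi; lia.
    have qp : h - 2 ^ k != q by clear -q1 q2 dlo dhi ah lo k0; lia.
    rewrite q3 qS /= (@coversI k) //; clear -q1 q2 dlo dhi lo hi k0 ah ltba; lia.
Qed.

(** * The ruler graph and its universality *)

(* The position of [i : 'I_n] is [i.+1], since position [0] has no valuation. *)
Definition ruler_rel (n : nat) : rel 'I_n :=
  [rel i j : 'I_n | ruler_adj i.+1 j.+1].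

Lemma ruler_sym (n : nat) : symmetric (@ruler_rel n).
Proof. by move=> i j; exact: orbC. Qed.

Lemma ruler_irr (n : nat) : irreflexive (@ruler_rel n).
Proof. by move=> i; rewrite /ruler_rel /= /ruler_adj /covers eqxx. Qed.

Definition ruler (n : nat) : sgraph 'I_n :=
  SGraph (@ruler_sym n) (@ruler_irr n).

(** An injective self-map of a finite type is bijective, so [T] is transported along its inverse to
    a subgraph on the full vertex set. *)
Lemma contains_of_injective (V : finType) (G T : sgraph V) (g : V -> V) :
  injective g -> (forall x y, T x y -> G (g x) (g y)) -> contains G T.
Proof.
move=> gI gT; have [g' gK g'K] := injF_bij gI.
pose k := [rel x y : {x : V | x \in [set: V]} | T (g' (val x)) (g' (val y))].
have ks : symmetric k by move=> x y; rewrite /= adj_sym.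
have ki : irreflexive k by move=> x; rewrite /= adj_irr.
exists [set: V], (SGraph ks ki); split.
  by move=> x y /= /gT; rewrite !g'K.
exists (fun x => Sub (g x) (in_setT (g x))) => [|x y] /=; last by rewrite !gK.
exists (fun u => g' (val u)) => [x|u] /=; first by rewrite gK.
by apply: val_inj; rewrite /= g'K.
Qed.

Lemma ruler_universal (n : nat) : tree_universal (ruler n).
Proof.
move=> T [_ acT]; have cT : #|[set: 'I_n]| = n by rewrite cardsT card_ord.
have [f [fI fS fT]] := (embeds_interval_hole acT cT).1 1 isT.
have fP x : (f x).-1 < n by have /= := fS x (in_setT x); lia.
have fE x : (f x).-1.+1 = f x by have /= := fS x (in_setT x); lia.
apply: (@contains_of_injective _ _ _ (fun x => Ordinal (fP x))) => [x y|x y Txy].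
  by move=> /(congr1 val) /= fxy; apply: fI; rewrite ?inE // -fE fxy fE.
by rewrite /= /ruler_rel /= !fE; apply: fT; rewrite ?inE.
Qed.

(** * Counting the edges *)

Lemma card_covers (n : nat) (i : 'I_n) :
  #|[set j : 'I_n | covers i.+1 j.+1]| <= 6 * 2 ^ logn 2 i.+1 - 2.
Proof.
set r := 2 ^ _; have r0 : 0 < r by rewrite expn_gt0.
(* At most [3 * r - 1] indices on each side; the left list is cut off at index 0. *)
pose s := iota i.+1 (3 * r).-1 ++ iota (i - (3 * r).-1) (minn i (3 * r).-1).
have ss : size s <= 6 * r - 2 by rewrite size_cat !size_iota; lia.
apply: leq_trans ss; rewrite cardE -(size_map (@nat_of_ord n)); apply: uniq_leq_size.
  by rewrite map_inj_uniq ?enum_uniq //; apply: ord_inj.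
move=> k /mapP[j]; rewrite mem_enum inE => /and3P[ij lij lji] ->.
rewrite -/r in lij lji. by rewrite mem_cat !mem_iota; lia.
Qed.

(** Each edge is charged to an endpoint that covers the other one. *)
Lemma num_edges_ruler (n : nat) :
  num_edges (ruler n) <= \sum_(i < n) (6 * 2 ^ logn 2 i.+1 - 2).
Proof.
pose P := [set p : 'I_n * 'I_n | covers p.1.+1 p.2.+1].
have sub : edges (ruler n) \subset [set [set p.1; p.2] | p in P].
  apply/subsetP => e /imsetP[[i j]]; rewrite inE /= => /orP[cij|cji] ->.
    by apply/imsetP; exists (i, j); rewrite ?inE.
  by apply/imsetP; exists (j, i); rewrite ?inE //= setUC.
apply: leq_trans (subset_leq_card sub) _; apply: leq_trans (leq_imset_card _ _) _.
rewrite -sum1_card (partition_big (fun p => p.1) xpredT) //=.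
apply: leq_sum => i _; apply: leq_trans (card_covers i).
have pairI : injective (pair i : 'I_n -> 'I_n * 'I_n) by move=> a b [].
rewrite sum1dep_card -(card_imset _ pairI).
apply: subset_leq_card; apply/subsetP => -[i' j]; rewrite !inE /= => /andP[cov].
by move=> /eqP i'E; rewrite i'E in cov *; apply: imset_f; rewrite inE.
Qed.

(** Write [2 ^ v] as 1 plus the sum of [2 ^ k] over [k < v] and exchange the sums: at most
    [n / 2 ^ k.+1] positions are divisible by [2 ^ k.+1], so each [k] contributes at most
    [n / 2]. *)
Lemma sum_two_part (n : nat) : 0 < n ->
  2 * (\sum_(i < n) 2 ^ logn 2 i.+1) <= n * (trunc_log 2 n).+2.
Proof.
move=> n0; set L := trunc_log 2 n.
have two_part p : 0 < p <= n ->
    2 ^ logn 2 p = 1 + \sum_(k < L) 2 ^ k * (2 ^ k.+1 %| p).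
  case/andP=> p0 pn.
  have vL : logn 2 p <= L.
    apply: trunc_log_max => //; apply: leq_trans pn.
    by apply: dvdn_leq => //; rewrite pfactor_dvdn.
  rewrite (eq_bigr (fun k : 'I_L => if k < logn 2 p then 2 ^ k else 0)).
    rewrite -big_mkcond -(big_ord_widen_cond _ xpredT (fun k => 2 ^ k)) //=.
    by have := predn_exp 2 (logn 2 p); rewrite mul1n add1n => <-; rewrite prednK ?expn_gt0.
  by move=> k _; rewrite pfactor_dvdn //; case: ifP; lia.
rewrite (eq_bigr _ (fun (i : 'I_n) _ => two_part i.+1 (ltn_ord i))) big_split /=.
rewrite sum1_card card_ord exchange_big /= mulnDr.
have le (k : 'I_L) : 2 * (\sum_(i < n) 2 ^ k * (2 ^ k.+1 %| i.+1)) <= n.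
  rewrite -big_distrr /= mulnA -expnS mulnC.
  have <- : n %/ 2 ^ k.+1 = \sum_(i < n) (2 ^ k.+1 %| i.+1).
    by rewrite divn_count_dvd big_add1 big_mkord.
  exact: leq_trunc_div.
rewrite -[L.+2]addn2 mulnDr [n * 2]mulnC addnC leq_add2r big_distrr /=.
rewrite [n * L]mulnC -[in L * n](card_ord L) -sum_nat_const.
by apply: leq_sum => k _; exact: le.
Qed.

Lemma num_edges_ruler_le (n : nat) : 0 < n ->
  num_edges (ruler n) <= 3 * n * trunc_log 2 n + 4 * n.
Proof.
move=> n0; apply: leq_trans (num_edges_ruler n) _.
(* Adding [2 * n] undoes the truncated subtractions of 2. *)
have : \sum_(i < n) (6 * 2 ^ logn 2 i.+1 - 2) + 2 * n =
       3 * (2 * \sum_(i < n) 2 ^ logn 2 i.+1).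
  rewrite mulnA big_distrr /= -[in 2 * n](card_ord n) mulnC -sum_nat_const.
  rewrite -big_split /=; apply: eq_bigr => i _.
  by have := expn_gt0 2 (logn 2 i.+1); lia.
by have := sum_two_part n0; nia.
Qed.

(** * The bound on [s n] *)

Lemma s_le (n : nat) (G : sgraph 'I_n) : tree_universal G -> s n <= num_edges G.
Proof.
move=> uG; rewrite /s; case: ex_minnP => m _; apply; apply/boolp.asboolP.
by exists G.
Qed.

Lemma trunc_log_le_log2 (R : realType) (n : nat) : 0 < n ->
  ((trunc_log 2 n)%:R <= log2 (n%:R : R))%R.
Proof.
move=> n0; have ln2 : (0 < ln 2 :> R)%R by rewrite ln_gt0 // ltr1n.
rewrite /log2 ler_pdivlMr // mulr_natl -lnXn // -natrX.
rewrite ler_ln ?posrE ?ltr0n ?expn_gt0 // ler_nat.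
by have /andP[] := trunc_log_bounds (isT : 1 < 2) n0.
Qed.

Unset Implicit Arguments.
Local Close Scope nat_scope.

Theorem theorem1 (R : realType) (n : nat) (hn : (1 <= n)%N) :
  (s n)%:R <= 7 / 2 * n%:R * log2 (n%:R : R) + 4 * n%:R.
Proof.
have le : ((s n)%:R <= (3 * n * trunc_log 2 n + 4 * n)%:R :> R).
  by rewrite ler_nat (leq_trans (s_le (@ruler_universal n))) ?num_edges_ruler_le.
(* The ruler gives the coefficient 3; a nonnegative logarithm allows raising it to 7/2. *)
have log_ge0 : 0 <= log2 (n%:R : R).
  by apply: le_trans (trunc_log_le_log2 R hn).
apply: le_trans le _; rewrite natrD !natrM lerD2r.
have := ler_wpM2l (ler0n R n) (trunc_log_le_log2 R hn).
have := mulr_ge0 (ler0n R n) log_ge0.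
lra.
Qed.
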